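(* The following identity holds: $$\sum_{\pi}\omega^c_\pi\,t^{\pi_{111}}\,q^{|\pi|}=e^{t(M(q)-1)},$$ where the sum is over all solid partitions $\pi$, $t$ is a formal variable, and $M(q)=\prod_{n\geqslant1}(1-q^n)^{-n}$ is the MacMahon function. In particular, when $t=1$, $\sum_\pi\omega^c_\pi\,q^{|\pi|}=e^{M(q)-1}$.
   Context: A solid partition $\pi=\{\pi_{ijk}\}_{i,j,k\geqslant1}$ is a sequence of non-negative integers with $\pi_{ijk}\geqslant\pi_{i+1,j,k}$, $\pi_{ijk}\geqslant\pi_{i,j+1,k}$, $\pi_{ijk}\geqslant\pi_{i,j,k+1}$ for all $i,j,k\geqslant1$ and finite size $|\pi|:=\sum\pi_{ijk}<\infty$. A plane partition $\xi=\{\xi_{ij}\}_{i,j\geqslant1}$ is a sequence of non-negative integers with $\xi_{ij}\geqslant\xi_{i+1,j}$, $\xi_{ij}\geqslant\xi_{i,j+1}$ and $|\xi|:=\sum\xi_{ij}<\infty$. Its binary representation is $\xi(i,j,k):=1$ if $k\leqslant\xi_{ij}$ and $0$ otherwise ($i,j,k\geqslant1$). For a non-empty solid partition $\pi$, let $\mathcal{C}_\pi$ be the (finite) set of families $\{m_\xi\}_\xi$ of non-negative integers, indexed by all non-empty plane partitions $\xi$, such that $\pi_{ijk}=\sum_\xi m_\xi\cdot\xi(i,j,k)$ for all $i,j,k\geqslant1$. Define $$\omega^c_\pi:=\sum_{\{m_\xi\}_\xi\in\mathcal{C}_\pi}\ \prod_\xi\frac{1}{(m_\xi)!},$$ and $\omega^c_\varnothing:=1$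 for the empty solid partition. *)

(* Defs.v *)
From HB Require Import structures.
From mathcomp Require Import all_boot all_order all_algebra.
From mathcomp Require Import all_classical.

Set Implicit Arguments.
Unset Strict Implicit.
Unset Printing Implicit Defensive.

Import GRing.Theory.
Local Open Scope classical_set_scope.
Local Open Scope ring_scope.

(******************************************************************************)
(*        {fps R} == formal power series in one variable q over R; f n is the *)
(*                   coefficient of q^n in f : {fps R}.  This is a            *)
(*                   comUnitRingType (with the Cauchy product).               *)
(*         fpsC c == the constant series c                                    *)
(*           fpsX == the variable q                                           *)
(*     fps_lim u  == the coefficientwise limit of the sequence u, that is,    *)
(*                   its n-th coefficient is the eventual value of u m n      *)
(*                   (0 if there is none)                                     *)
(*   fps_sum A F  == the formal sum of the family F over the set A, for F     *)
(*                   with finitely many nonzero n-th coefficients for each n  *)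
(*     fps_exp f  == \sum_k f^k / k!, for f with zero constant coefficient    *)
(*  macmahon R    == \prod_(n >= 1) (1 - q^n)^-n in {fps R}                   *)
(******************************************************************************)

Record fps (R : Type) := Fps { fps_coef :> nat -> R }.

Notation "{ 'fps' R }" := (fps R) (at level 0, format "{ 'fps'  R }").

Section FpsRing.
Variable R : comNzRingType.
Implicit Types f g h : {fps R}.

HB.instance Definition _ := gen_eqMixin {fps R}.
HB.instance Definition _ := gen_choiceMixin {fps R}.

Lemma fpsP f g : (forall n, f n = g n) <-> f = g.
Proof.
split=> [|->//]; case: f g => f [g] /= fg; congr Fps; exact/funext.
Qed.

Definition fpsC (c : R) : {fps R} := Fps (fun n => if n == 0%N then c else 0).
Definition fpsX : {fps R} := Fps (fun n => (n == 1%N)%:R).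

Definition fps_add f g : {fps R} := Fps (fun n => f n + g n).
Definition fps_opp f : {fps R} := Fps (fun n => - f n).
Definition fps_mul f g : {fps R} :=
  Fps (fun n => \sum_(i < n.+1) f i * g (n - i)%N).

Lemma fps_addA : associative fps_add.
Proof. by move=> f g h; apply/fpsP => n /=; rewrite addrA. Qed.
Lemma fps_addC : commutative fps_add.
Proof. by move=> f g; apply/fpsP => n /=; rewrite addrC. Qed.
Lemma fps_add0 : left_id (fpsC 0) fps_add.
Proof. by move=> f; apply/fpsP => n /=; rewrite if_same add0r. Qed.
Lemma fps_addN : left_inverse (fpsC 0) fps_opp fps_add.
Proof. by move=> f; apply/fpsP => n /=; rewrite if_same addNr. Qed.

HB.instance Definition _ :=
  GRing.isZmodule.Build {fps R} fps_addA fps_addC fps_add0 fps_addN.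

Let trunc n f : {poly R} := \poly_(i < n.+1) f i.

Let coef_trunc n f i : (i <= n)%N -> (trunc n f)`_i = f i.
Proof. by move=> lein; rewrite coef_poly ltnS lein. Qed.

Let fps_mul_trunc n f g i : (i <= n)%N ->
  fps_mul f g i = (trunc n f * trunc n g)`_i.
Proof.
move=> lein; rewrite coefM /=; apply: eq_bigr => -[j /= ltji] _.
rewrite !coef_trunc //; first exact: leq_trans (leq_subr _ _) lein.
by rewrite -ltnS (leq_trans ltji).
Qed.

Lemma fps_mulC : commutative fps_mul.
Proof. by move=> f g; apply/fpsP => n; rewrite !(fps_mul_trunc _ _ (leqnn n)) mulrC. Qed.

Lemma fps_mulA : associative fps_mul.
Proof.
move=> f g h; apply/fpsP => n.
transitivity (trunc n f * (trunc n g * trunc n h))`_n.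
  rewrite coefM /=; apply: eq_bigr => -[i /= ltin] _.
  rewrite coef_trunc // -fps_mul_trunc //; exact: leq_subr.
rewrite mulrA coefM /=; apply: eq_bigr => -[i /= ltin] _.
rewrite (coef_trunc _ (leq_subr i n)) -fps_mul_trunc //.
Qed.

Lemma fps_mul1 : left_id (fpsC 1) fps_mul.
Proof.
move=> f; apply/fpsP => n /=; rewrite big_ord_recl /= mul1r subn0.
by rewrite big1 ?addr0// => i _; rewrite mul0r.
Qed.

Lemma fps_mulDl : left_distributive fps_mul fps_add.
Proof.
move=> f g h; apply/fpsP => n /=; rewrite -big_split.
by apply: eq_bigr => i _; rewrite mulrDl.
Qed.

Lemma fps_1neq0 : fpsC 1 != 0.
Proof. by apply/eqP => /fpsP/(_ 0%N) /= /eqP; rewrite oner_eq0. Qed.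

HB.instance Definition _ := GRing.Zmodule_isComNzRing.Build {fps R}
  fps_mulA fps_mulC fps_mul1 fps_mulDl fps_1neq0.

Definition fps_unit : pred {fps R} := fun f => `[< exists g, g * f = 1 >].
Definition fps_inv f : {fps R} := xget f [set g | g * f = 1].

Lemma fps_mulV : {in fps_unit, left_inverse 1 fps_inv *%R}.
Proof.
by move=> f /asboolP[g gf]; rewrite /fps_inv; case: xgetP => // /(_ g).
Qed.
Lemma fps_unitP f g : g * f = 1 -> fps_unit f.
Proof. by move=> gf; apply/asboolP; exists g. Qed.
Lemma fps_inv_out : {in [predC fps_unit], fps_inv =1 id}.
Proof.
move=> f /negP fNunit; rewrite /fps_inv; case: xgetP => // g _ /= gf.
by case: fNunit; exact: fps_unitP gf.
Qed.

HB.instance Definition _ := GRing.ComNzRing_hasMulInverse.Build {fps R}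
  fps_mulV fps_unitP fps_inv_out.

Definition fps_lim (u : nat -> {fps R}) : {fps R} :=
  Fps (fun n => xget 0 [set c | exists N, forall m, (N <= m)%N -> u m n = c]).

Lemma fps_limP (u : nat -> {fps R}) f :
  (forall n, exists N, forall m, (N <= m)%N -> u m n = f n) -> fps_lim u = f.
Proof.
move=> uf; apply/fpsP => n /=; have [N uN] := uf n; apply: xget_unique.
  by exists N.
move=> c [N' uN']; rewrite -(uN (maxn N N')) ?leq_maxl//.
by rewrite uN' ?leq_maxr.
Qed.

Definition fps_sum (I : choiceType) (A : set I) (F : I -> {fps R}) : {fps R} :=
  Fps (fun n => \sum_(i \in A) F i n).

Definition fps_exp f : {fps R} :=
  fps_lim (fun N => \sum_(k < N) f ^+ k / (k`!)%:R).

Definition macmahon : {fps R} :=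
  fps_lim (fun N => \prod_(1 <= n < N) (1 - fpsX ^+ n) ^- n).

End FpsRing.
Arguments fpsX {R}.
Arguments macmahon R : clear implicits.

(* Indices of partitions start at 0 instead of 1. *)

Definition plane_partition : set (nat -> nat -> nat) :=
  [set xi | [/\ forall i j, (xi i.+1 j <= xi i j)%N,
                forall i j, (xi i j.+1 <= xi i j)%N &
                finite_set [set p : nat * nat | xi p.1 p.2 != 0%N]]].

Definition nonempty_plane_partition : set (nat -> nat -> nat) :=
  [set xi | plane_partition xi /\ exists i j, xi i j != 0%N].

(* xi(i, j, k) = 1 if k <= xi_ij with k >= 1 becomes k < xi_ij with k >= 0. *)
Definition binary_repr (xi : nat -> nat -> nat) (i j k : nat) : nat :=
  (k < xi i j)%N.

Definition solid_partition : set (nat -> nat -> nat -> nat) :=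
  [set pi | [/\ forall i j k, (pi i.+1 j k <= pi i j k)%N,
                forall i j k, (pi i j.+1 k <= pi i j k)%N,
                forall i j k, (pi i j k.+1 <= pi i j k)%N &
                finite_set
                  [set p : nat * nat * nat | pi p.1.1 p.1.2 p.2 != 0%N]]].

Definition solid_size (pi : nat -> nat -> nat -> nat) : nat :=
  \sum_(p \in [set: nat * nat * nat]) pi p.1.1 p.1.2 p.2.

(* The finiteness of the support of m makes the sums meaningful; for nonzero  *)
(* pi it is forced by the equation at (0, 0, 0), where binary_repr is 1.      *)
Definition decompositions (pi : nat -> nat -> nat -> nat) :
    set (nonempty_plane_partition -> nat) :=
  [set m | finite_set [set xi | m xi != 0%N] /\
     forall i j k, pi i j k =
       \sum_(xi \in [set: nonempty_plane_partition])
         (m xi * binary_repr (val xi) i j k)%N].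

Definition omega_c (pi : nat -> nat -> nat -> nat) : rat :=
  if `[< forall i j k, pi i j k = 0%N >] then 1
  else \sum_(m \in decompositions pi)
         \big[*%R/1]_(xi \in [set: nonempty_plane_partition])
           ((m xi)`!%:R^-1 : rat).

(* Main.v *)
(** Cutting a plane partition along its diagonals gives a sequence of interlacing partitions
    that first grows from the empty partition and then shrinks back to it. If an up step
    [l -> nu] is followed by a down step [nu -> m], then replacing [nu_(k+1)] by
    [min(l_k, m_k) + max(l_(k+1), m_(k+1)) - nu_(k+1)] yields a partition interlacing below both
    [l] and [m], and the surplus [nu_0 - max(l_0, m_0)] is an arbitrary natural number. Moving
    all down steps to the front in this way turns the plane partition into a matrix [A] of
    natural numbers with [|xi| = \sum (i + j + 1) A_ij], which is MacMahon's formula.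

    A family [m] of multiplicities contributes [\prod_xi t^(m_xi) / m_xi!] to the coefficient of
    [q^(\sum m_xi |xi|)], and the solid partition [pi] that it decomposes has this size and
    satisfies [pi_111 = \sum m_xi]. Summing over all families gives
    [\prod_xi exp (t q^|xi|) = exp (t \sum_xi q^|xi|)]. *)

From HB Require Import structures.
Require Import Defs.
From mathcomp Require Import all_boot all_order all_algebra.
From mathcomp Require Import finmap.
From mathcomp Require Import all_classical.
From mathcomp Require Import zify.
Import GRing.Theory.
Set Implicit Arguments.
Unset Strict Implicit.
Unset Printing Implicit Defensive.
Local Open Scope classical_set_scope.

Local Notation zero_part := (fun=> 0%N : nat).
Local Notation npp := (set_type nonempty_plane_partition).

(** * Interlacing chains *)

Definition interlace (l m : nat -> nat) : Prop :=
  forall k, (m k <= l k)%N /\ (l k.+1 <= m k)%N.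

(** If [nu] interlaces above [l] and [m], then [nu_(k+1)] lies between [max(l_(k+1), m_(k+1))] and
    [min(l_k, m_k)]. The toggle reflects it in this interval, which is also the range allowed for
    the k-th part of a partition below both; so no subtraction truncates. *)
Definition toggle_down (l m nu : nat -> nat) : nat -> nat := fun k =>
  (minn (l k) (m k) + maxn (l k.+1) (m k.+1) - nu k.+1)%N.

(** The same reflections, shifted by one index. The new first part is bounded only from below, hence
    the free parameter [n]. *)
Definition toggle_up (l m ka : nat -> nat) (n : nat) : nat -> nat := fun k =>
  if k is k'.+1 then (minn (l k') (m k') + maxn (l k'.+1) (m k'.+1) - ka k')%N
  else (n + maxn (l 0) (m 0))%N.

Lemma interlace_toggle_down l m nu : interlace nu l -> interlace nu m ->
  interlace l (toggle_down l m nu) /\ interlace m (toggle_down l m nu).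
Proof.
move=> nul num; rewrite /interlace /toggle_down.
by split=> k; have := nul k; have := num k; have := nul k.+1; have := num k.+1; lia.
Qed.

Lemma interlace_toggle_up l m ka n : interlace l ka -> interlace m ka ->
  interlace (toggle_up l m ka n) l /\ interlace (toggle_up l m ka n) m.
Proof.
move=> lka mka; rewrite /interlace /toggle_up.
have := lka 0; have := mka 0.
by split=> -[|k]; [| have := lka k; have := mka k; have := lka k.+1;
  have := mka k.+1 | | have := lka k; have := mka k; have := lka k.+1;
  have := mka k.+1]; lia.
Qed.

Lemma toggle_downK l m nu : interlace nu l -> interlace nu m ->
  toggle_up l m (toggle_down l m nu) (nu 0 - maxn (l 0) (m 0)) = nu.
Proof.
move=> nul num; apply/funext => -[|k]; rewrite /toggle_up /toggle_down.
  by have := nul 0; have := num 0; lia.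
by have := nul k; have := num k; have := nul k.+1; have := num k.+1; lia.
Qed.

Lemma toggle_upK l m ka n : interlace l ka -> interlace m ka ->
  toggle_down l m (toggle_up l m ka n) = ka.
Proof.
move=> lka mka; apply/funext => k; rewrite /toggle_up /toggle_down;
by have := lka k; have := mka k; lia.
Qed.

Definition psize K (l : nat -> nat) : nat := \sum_(k < K) l k.

Lemma interlace_psize K l m : interlace l m -> (psize K m <= psize K l)%N.
Proof. by move=> lm; apply: leq_sum => k _; case: (lm k). Qed.

(** Reflection gives [nu_(k+1) + ka_k = min(l_k, m_k) + max(l_(k+1), m_(k+1))]; summed over k, the
    min and the max of equal index combine into [l_k + m_k]. *)
Lemma psize_toggle K l m nu : interlace nu l -> interlace nu m -> m K = 0 ->
  (psize K.+1 nu + psize K.+1 (toggle_down l m nu) =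
   nu 0 - maxn (l 0) (m 0) + psize K.+1 l + psize K.+1 m)%N.
Proof.
move=> nul num mK0.
have [lka mka] := interlace_toggle_down nul num.
have kaK : toggle_down l m nu K = 0 by have := mka K; lia.
(* In the partial sums the last max still lacks its min, which is added by hand. It vanishes at
   [J = K] because [m K = 0]. *)
suff H J : (psize J.+1 nu + psize J (toggle_down l m nu) + minn (l J) (m J) =
    nu 0 - maxn (l 0) (m 0) + psize J.+1 l + psize J.+1 m)%N.
  have -> : psize K.+1 (toggle_down l m nu) = psize K (toggle_down l m nu).
    by rewrite /psize big_ord_recr /= kaK addn0.
  by have := H K; rewrite mK0; lia.
elim: J => [|J IH].
  rewrite /psize !big_ord_recr !big_ord0 /=; have := nul 0; have := num 0; lia.
have psizeS L p : psize L.+1 p = (psize L p + p L)%N by rewrite /psize big_ord_recr.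
rewrite (psizeS J.+1) (psizeS J (toggle_down _ _ _)) (psizeS J.+1 l) (psizeS J.+1 m).
move: IH; rewrite /toggle_down; have := nul J; have := num J.
have := nul J.+1; have := num J.+1; lia.
Qed.

(* A letter [(true, a)] is an up step weighted by [q^a], [(false, b)] a down *)
(* step weighted by [q^b]; weights are recorded through their exponents.     *)
Fixpoint chain (l : nat -> nat) (w : seq (bool * nat)) (s : seq (nat -> nat)) :
    Prop :=
  match w, s with
  | [::], [::] => l = fun=> 0%N
  | (u, _) :: w', m :: s' =>
      (if u then interlace m l else interlace l m) /\ chain m w' s'
  | _, _ => False
  end.

Fixpoint chain_wt K (l : nat -> nat) (w : seq (bool * nat))
    (s : seq (nat -> nat)) : nat :=
  match w, s with
  | (u, a) :: w', m :: s' =>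
      (a * (if u then psize K m - psize K l else psize K l - psize K m)
       + chain_wt K m w' s')%N
  | _, _ => 0%N
  end.

Definition downs (bs : seq nat) : seq (bool * nat) := [seq (false, b) | b <- bs].
Definition ups (a : seq nat) : seq (bool * nat) := [seq (true, b) | b <- a].

(* Turns a chain from [l] that makes one up step and then only down steps into a *)
(* chain from [l] making the same down steps; the numbers recorded are the        *)
(* surpluses of the local moves.                                                  *)
Fixpoint row_insert (l : nat -> nat) (s : seq (nat -> nat)) :
    seq nat * seq (nat -> nat) :=
  match s with
  | nu :: ((m :: _) as s1) =>
      let ka := toggle_down l m nu in
      let r := row_insert ka s1 in
      ((nu 0 - maxn (l 0) (m 0))%N :: r.1, ka :: r.2)
  | _ => ([::], [::])
  end.

(** Moves are undone from the right: inverting the one at [l] requires the next partition of the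
    original chain, which heads the part already rebuilt. *)
Fixpoint row_extract (l : nat -> nat) (ns : seq nat) (t : seq (nat -> nat)) :
    seq (nat -> nat) :=
  match ns, t with
  | n :: ns', ka :: t' =>
      let s1 := row_extract ka ns' t' in
      toggle_up l (head (fun=> 0%N) s1) ka n :: s1
  | _, _ => [:: fun=> 0%N]
  end.

Lemma row_insert_cons l nu m s :
  row_insert l (nu :: m :: s) =
  ((nu 0 - maxn (l 0) (m 0))%N :: (row_insert (toggle_down l m nu) (m :: s)).1,
   toggle_down l m nu :: (row_insert (toggle_down l m nu) (m :: s)).2).
Proof. by []. Qed.

Definition row_wt (a : nat) (bs ns : seq nat) : nat :=
  \sum_(j < size bs) (a + nth 0 bs j) * nth 0 ns j.

(** A down step removes at most one part, so the number of remaining down steps bounds the number of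
    parts. *)
Lemma chain_downs_zero l bs s k : chain l (downs bs) s -> (size bs <= k)%N -> l k = 0.
Proof.
elim: bs l s k => [|b bs IH] l [|m s] k //=; first by move=> ->.
by move=> [lm ch] ltk; case: k ltk => // k /(IH m s k ch) mk; have := lm k; lia.
Qed.

(** By [psize_toggle], exchanging an up step of exponent [a] with a down step of exponent [b] lowers
    the weight by [(a + b) n], with [n] the surplus. The bound on [K] ensures that [psize K] misses
    no part of the partitions reached by down steps. *)
Lemma row_insertP K a bs l s : (size bs <= K)%N -> chain l ((true, a) :: downs bs) s ->
  [/\ size (row_insert l s).1 = size bs,
      chain l (downs bs) (row_insert l s).2,
      row_extract l (row_insert l s).1 (row_insert l s).2 = s &
      chain_wt K l ((true, a) :: downs bs) s =
        (row_wt a bs (row_insert l s).1 +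
         chain_wt K l (downs bs) (row_insert l s).2)%N].
Proof.
elim: bs l s => [|b bs IH] l.
  move=> [|nu [|m s]] _ //=; last by case.
  move=> [nul nu0]; have l0 : l = fun=> 0%N.
    by apply/funext => k; have := nul k; rewrite nu0; lia.
  split=> //; first by rewrite nu0.
  by rewrite nu0 l0 /row_wt big_ord0 subnn muln0.
case=> [|nu [|m s]] szK; [by []|by case|]; rewrite /= in szK.
move=> [nul [num ch]].
have [lka mka] := interlace_toggle_down nul num.
set ka := toggle_down l m nu in lka mka *.
have ch1 : chain ka ((true, a) :: downs bs) (m :: s) by [].
have [sz1 ch2 K1 W1] := IH ka (m :: s) (ltnW szK) ch1.
have K0 : (0 < K)%N by exact: leq_trans szK.
have mK : m K.-1 = 0 by apply: (chain_downs_zero ch); rewrite -ltnS prednK.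
have E := psize_toggle nul num mK; rewrite prednK // in E.
rewrite row_insert_cons -/ka; move: sz1 ch2 K1 W1.
case: (row_insert ka (m :: s)) => [ns t] sz1 ch2 K1 W1.
split=> /=; rewrite ?sz1 ?K1 /= ?toggle_downK //.
rewrite /row_wt [size (b :: _)]/= big_ord_recl /= -/(row_wt a bs ns).
rewrite /= in W1.
have := interlace_psize K lka; have := interlace_psize K mka.
have := interlace_psize K nul; have := interlace_psize K num.
rewrite -/ka in E.
move: W1 E.
set A := psize K nu; set B := psize K m; set C := psize K l; set D := psize K ka.
set n := (nu 0 - _)%N; set w := chain_wt K m _ _.
move=> W1 E *.
(* The size identity in the form needed for the exponents [a] and [b]; the interlacing inequalities
   keep the differences from truncating. *)
have -> : (A - C = n + (B - D))%N by lia.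
have -> : (A - B = n + (C - D))%N by lia.
by rewrite -/(downs bs) !mulnDr mulnDl; lia.
Qed.

Lemma row_extractP a bs l ns t : size ns = size bs -> chain l (downs bs) t ->
  chain l ((true, a) :: downs bs) (row_extract l ns t) /\
  row_insert l (row_extract l ns t) = (ns, t).
Proof.
elim: bs l ns t => [|b bs IH] l [|n ns] //.
  by move=> [|? ?] //= _ ->; split=> //; split=> // k.
case=> [|ka t] //= [sz] [lka ch].
have [] := IH ka ns t sz ch; set s1 := row_extract ka ns t.
case: s1 => [|m s] //= [mka ch1] R.
have [upl upm] := interlace_toggle_up n lka mka.
split; first by [].
by rewrite toggle_upK // R /= addnK.
Qed.

(** The last of the [n] up steps is the first to pass the down steps; each earlier one then meets
    the chain of down steps left by its successors. *)
Fixpoint insert_rows (l : nat -> nat) (n : nat) (s : seq (nat -> nat)) :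
    seq (seq nat) * seq (nat -> nat) :=
  if n is n'.+1 then
    if s is nu :: s' then
      let r := insert_rows nu n' s' in
      let r' := row_insert l (nu :: r.2) in
      (r'.1 :: r.1, r'.2)
    else ([::], [::])
  else ([::], s).

Fixpoint extract_rows (l : nat -> nat) (nss : seq (seq nat)) (t : seq (nat -> nat)) :
    seq (nat -> nat) :=
  if nss is ns :: nss' then
    let s1 := row_extract l ns t in
    let nu := head (fun=> 0%N) s1 in
    nu :: extract_rows nu nss' (behead s1)
  else t.

Definition matrix_shape (M N : nat) (nss : seq (seq nat)) : Prop :=
  size nss = M /\ all (fun ns => size ns == N) nss.

Definition matrix_wt (a b : seq nat) (nss : seq (seq nat)) : nat :=
  \sum_(i < size a) row_wt (nth 0 a i) b (nth [::] nss i).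

Lemma insert_rowsP K a bs l s : (size bs <= K)%N -> chain l (ups a ++ downs bs) s ->
  [/\ matrix_shape (size a) (size bs) (insert_rows l (size a) s).1,
      chain l (downs bs) (insert_rows l (size a) s).2,
      extract_rows l (insert_rows l (size a) s).1 (insert_rows l (size a) s).2 = s &
      chain_wt K l (ups a ++ downs bs) s =
        (matrix_wt a bs (insert_rows l (size a) s).1 +
         chain_wt K l (downs bs) (insert_rows l (size a) s).2)%N].
Proof.
move=> szK; elim: a l s => [|a al IH] l s.
  by move=> ch; split=> //; rewrite /matrix_wt big_ord0.
case: s => [|nu s]; first by [].
move=> [nul ch]; have [[sz1 sz2] ch2 K1 W1] := IH nu s ch.
have ch3 : chain l ((true, a) :: downs bs) (nu :: (insert_rows nu (size al) s).2) by [].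
have [sz3 ch4 K3 W3] := row_insertP szK ch3.
rewrite [insert_rows _ _ _]/=; rewrite [fst (_, _)]/= [snd (_, _)]/=.
split=> //.
- by split=> /=; rewrite ?sz1 // sz2 sz3 eqxx.
- by rewrite [extract_rows _ _ _]/= K3 /= K1.
rewrite /matrix_wt [size (_ :: _)]/= big_ord_recl /=.
rewrite -/(matrix_wt _ _ _) -/(ups _) W1.
by move: W3 => /=; rewrite -/(downs _) -/(matrix_wt al bs _); lia.
Qed.

Lemma extract_rowsP a bs l nss t : matrix_shape (size a) (size bs) nss ->
  chain l (downs bs) t ->
  chain l (ups a ++ downs bs) (extract_rows l nss t) /\
  insert_rows l (size a) (extract_rows l nss t) = (nss, t).
Proof.
elim: a l nss t => [|a al IH] l [|ns nss] t; [by []|by case|by case|].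
move=> [[sz]] /= /andP[/eqP szn al1] ch.
have [] := row_extractP a szn ch.
case: (row_extract l ns t) => [|nu s] //= [nul ch1] R.
have [ch2 I2] := IH nu nss s (conj sz al1) ch1.
by split=> //; rewrite I2 /= R.
Qed.

(** * Diagonal slices *)

Lemma chain_nthP l w s : chain l w s <->
  [/\ size s = size w,
      forall p, (p < size w)%N ->
        if (nth (true, 0%N) w p).1
        then interlace (nth zero_part s p) (nth zero_part (l :: s) p)
        else interlace (nth zero_part (l :: s) p) (nth zero_part s p) &
      last l s = zero_part].
Proof.
elim: w l s => [|[u a] w IH] l [|m s] /=; try by split=> // -[].
split=> [[st /IH[sz H la]]|[[sz] H la]].
  by split; rewrite ?sz // => -[|p] //= /H; rewrite /=.
split; first exact: (H 0).
by apply/IH; split=> // p pw; exact: (H p.+1).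
Qed.

(** Summation by parts: consecutive exponents differ by one, so every later partition is counted
    once. *)
Lemma chain_wt_downs K l e N s : chain l (downs (iota e N)) s ->
  chain_wt K l (downs (iota e N)) s = (e * psize K l + \sum_(m <- s) psize K m)%N.
Proof.
elim: N e l s => [|N IH] e l [|m s] //=.
  by move=> ->; rewrite /psize big1 // big_nil muln0.
move=> [/(interlace_psize K) lm ch]; rewrite -/(downs _) IH // big_cons.
rewrite mulnBr; have : (e * psize K m <= e * psize K l)%N by rewrite leq_mul2l lm orbT.
lia.
Qed.

(* With these exponents the weights telescope to the total size of the chain. *)
Definition diag_word N := ups (rev (iota 1 N)) ++ downs (iota 0 N).

Lemma chain_wt_ups K l e N s :
  chain l (ups (rev (iota 1 e)) ++ downs (iota 0 N)) s ->
  (chain_wt K l (ups (rev (iota 1 e)) ++ downs (iota 0 N)) s + e * psize K l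
   = \sum_(m <- s) psize K m)%N.
Proof.
elim: e l s => [|e IH] l s.
  by move=> ch; rewrite /= mul0n addn0 chain_wt_downs.
have -> : iota 1 e.+1 = iota 1 e ++ [:: e.+1] by rewrite -[e.+1 in LHS]addn1 iotaD add1n.
rewrite rev_cat; case: s => [|m s] //= [/(interlace_psize K) ml ch].
rewrite big_cons -(IH m s ch) -[_ ++ downs _]/(ups (rev (iota 1 e)) ++ downs (iota 0 N))
  mulnBr !mulSn.
have : (e * psize K l <= e * psize K m)%N by rewrite leq_mul2l ml orbT.
lia.
Qed.

Lemma chain_wt_diag K N s : chain zero_part (diag_word N) s ->
  chain_wt K zero_part (diag_word N) s = (\sum_(m <- s) psize K m)%N.
Proof.
by move=> ch; rewrite -(chain_wt_ups K ch) /psize big1 // muln0 addn0.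
Qed.

(** Entry p of [s] is the partition reached after step p, so entry n is the peak, the main diagonal.
    The first up step, from the empty partition, only says that entry 0 has at most one part. *)
Lemma chain_diagP n s : chain zero_part (diag_word n.+1) s <->
  [/\ size s = (n.+1).*2,
      forall k, nth zero_part s 0 k.+1 = 0,
      forall p, (p < n)%N -> interlace (nth zero_part s p.+1) (nth zero_part s p),
      forall p, (n <= p <= n.*2)%N ->
        interlace (nth zero_part s p) (nth zero_part s p.+1) &
      nth zero_part s n.*2.+1 = zero_part].
Proof.
have szw : size (diag_word n.+1) = n.+1.*2.
  by rewrite size_cat !size_map size_rev !size_iota addnn.
have nw p : (p < n.+1.*2)%N -> (nth (true, 0%N) (diag_word n.+1) p).1 = (p <= n)%N.
  move=> pn; rewrite nth_cat /ups /downs size_map size_rev size_iota ltnS.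
  case: leqP => np; last by rewrite (nth_map 0) // size_iota; lia.
  by rewrite (nth_map 0) // size_rev size_iota.
rewrite chain_nthP szw; split=> [[sz H la]|[sz H0 HU HD la]].
  split=> //.
  - by move=> k; have := H 0 isT; rewrite nw // => /(_ k) /= []; lia.
  - by move=> p pn; have := H p.+1; rewrite nw; [rewrite pn; apply; lia | lia].
  - move=> p pn; have := H p.+1; rewrite nw; last by lia.
    by rewrite ifF; [apply; lia | lia].
  - by rewrite -[RHS]la (last_nth zero_part) sz.
split=> //; last by rewrite (last_nth zero_part) sz.
move=> p pn; rewrite nw //; case: leqP => np; case: p pn np => [|p] pn np //=.
- by move=> k; split=> //=; rewrite H0.
- exact: HU.
- by apply: HD; lia.
Qed.

(** Each step changes the number of parts by at most one, so entry p has at most [p + 1] parts,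
    counting from the start, and at most [2n + 1 - p], counting from the end. Beyond the end the
    default is the empty partition. *)
Lemma chain_diag_zero n s p k : chain zero_part (diag_word n.+1) s ->
  (p < k)%N || (n.*2.+1 <= p + k)%N -> nth zero_part s p k = 0.
Proof.
move=> /chain_diagP[sz H0 HU HD la]; case: (leqP n.*2.+2 p) => [np _|].
  by rewrite nth_default // sz; lia.
move=> pn /orP[|].
  elim: p k pn => [|p IH] [|k] pn // pk.
  case: (ltnP p n) => np.
    by have [_] := HU p np k; rewrite (IH k); lia.
  have /HD/(_ k.+1)[] : (n <= p <= n.*2)%N by lia.
  by rewrite (IH k.+1); lia.
have [r] : {r | r = n.*2.+1 - p}%N by exists (n.*2.+1 - p)%N.
elim: r p k pn => [|r IH] p k pn rE pk.
  by have -> : p = n.*2.+1 by [lia]; rewrite la.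
case: (ltnP p n) => np.
  by have [] := HU p np k; rewrite (IH p.+1 k); lia.
case: k pk => [|k] pk; first by lia.
have /HD/(_ k)[] : (n <= p <= n.*2)%N by lia.
by rewrite (IH p.+1 k); lia.
Qed.

Definition plane_size (xi : nat -> nat -> nat) : nat :=
  (\sum_(p \in [set: nat * nat]) xi p.1 p.2)%R.

Definition boxed n (xi : nat -> nat -> nat) : Prop :=
  forall i j, (n < i)%N || (n < j)%N -> xi i j = 0.

(* The diagonals of an array supported in [0, n] x [0, n], from the lower left *)
(* corner to the upper right one; one of the truncated differences is zero.    *)
Definition slices n (xi : nat -> nat -> nat) : seq (nat -> nat) :=
  mkseq (fun p k => xi (k + (n - p)) (k + (p - n)))%N (n.+1).*2.

(** The cell [(i, j)] is on diagonal [n + j - i], at position [min(i, j)]. *)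
Definition unslice n (s : seq (nat -> nat)) : nat -> nat -> nat := fun i j =>
  if (i <= n)%N && (j <= n)%N then nth zero_part s (n + j - i) (minn i j) else 0.

Lemma nth_slices n xi p : (p <= n.*2.+1)%N ->
  nth zero_part (slices n xi) p = fun k => xi (k + (n - p))%N (k + (p - n))%N.
Proof. by move=> pn; rewrite nth_mkseq //; lia. Qed.

Lemma slicesP n xi : plane_partition xi -> boxed n xi ->
  chain zero_part (diag_word n.+1) (slices n xi).
Proof.
move=> [xi1 xi2 _] bx; apply/chain_diagP; split.
- by rewrite size_mkseq.
- by move=> k; rewrite nth_slices // bx //; lia.
- move=> p pn k; rewrite !nth_slices; [|lia|lia].
  have -> : (p - n = 0)%N by [lia]; have -> : (p.+1 - n = 0)%N by lia.
  have -> : (n - p = (n - p.+1).+1)%N by lia.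
  by rewrite !addn0 addnS; split; [exact: xi1 | rewrite addSn; exact: xi2].
- move=> p pn k; rewrite !nth_slices; [|lia|lia].
  have -> : (n - p = 0)%N by [lia]; have -> : (n - p.+1 = 0)%N by lia.
  have -> : (p.+1 - n = (p - n).+1)%N by lia.
  by rewrite !addn0 addnS; split; [exact: xi2 | rewrite addSn; exact: xi1].
- by rewrite nth_slices //; apply/funext => k; rewrite bx //; lia.
Qed.

Lemma slicesK n xi : boxed n xi -> unslice n (slices n xi) = xi.
Proof.
move=> bx; apply/funext => i; apply/funext => j; rewrite /unslice.
case: ifPn => [/andP[ni nj]|nij]; last by rewrite bx //; lia.
by rewrite nth_slices; [congr (xi _ _); lia | lia].
Qed.

Lemma unsliceK n s : chain zero_part (diag_word n.+1) s -> slices n (unslice n s) = s.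
Proof.
move=> ch; have := ch; move=> /chain_diagP[sz H0 HU HD la].
apply: (@eq_from_nth _ zero_part); first by rewrite size_mkseq.
move=> p; rewrite size_mkseq => pn; rewrite nth_slices; last by lia.
apply/funext => k; rewrite /unslice; case: ifPn => [/andP[ni nj]|nij].
  by congr (nth _ s _ _); lia.
by rewrite (chain_diag_zero ch) //; lia.
Qed.

Lemma unslice_boxed n s : boxed n (unslice n s).
Proof. by move=> i j nij; rewrite /unslice ifF //; lia. Qed.

Lemma boxed_finite n xi : boxed n xi ->
  finite_set [set p : nat * nat | xi p.1 p.2 != 0%N].
Proof.
move=> bx; apply: (@sub_finite_set _ _ (`I_n.+1 `*` `I_n.+1)); last first.
  by apply: finite_setX; exact: finite_II.
move=> [i j] /= xi0; apply/andP; apply: contra_neqT xi0 => nij; apply: bx; lia.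
Qed.

Lemma unsliceP n s : chain zero_part (diag_word n.+1) s ->
  plane_partition (unslice n s).
Proof.
move=> ch; have := ch; move=> /chain_diagP[sz H0 HU HD la].
split; last exact: boxed_finite (@unslice_boxed n s).
- move=> i j; rewrite /unslice; case: ifPn => // nij; rewrite ifT; last by lia.
  case: (leqP j i) => ji.
    have /HU/(_ j)[H _] : (n + j - i.+1 < n)%N by lia.
    have -> : minn i.+1 j = j by lia.
    by have -> : (n + j - i = (n + j - i.+1).+1)%N by lia.
  have /HD/(_ i)[_ H] : (n <= n + j - i.+1 <= n.*2)%N by lia.
  have -> : minn i.+1 j = i.+1 by lia.
  by have -> : (n + j - i = (n + j - i.+1).+1)%N by lia.
- move=> i j; rewrite /unslice; case: ifPn => // nij; rewrite ifT; last by lia.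
  have -> : (n + j.+1 - i = (n + j - i).+1)%N by lia.
  case: (leqP i j) => ij.
    have /HD/(_ i)[H _] : (n <= n + j - i <= n.*2)%N by lia.
    by have -> : minn i j.+1 = i by lia.
  have /HU/(_ j)[_ H] : (n + j - i < n)%N by lia.
  by have -> : minn i j.+1 = j.+1 by lia.
Qed.

Lemma psize_slices n xi : boxed n xi ->
  \sum_(m <- slices n xi) psize n.+1 m = plane_size xi.
Proof.
move=> bx; rewrite big_map -[X in iota 0 X]subn0 -/(index_iota 0 _) big_mkord /psize.
(* Sends position k on diagonal p to its cell. The image of [B] contains the whole square, and [xi]
   vanishes on its other cells. *)
pose g (x : nat * nat) := (x.2 + (n - x.1), x.2 + (x.1 - n))%N.
have ginj : injective g.
  by move=> [p k] [p' k']; rewrite /g /= => -[e1 e2]; congr (_, _); lia.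
pose B := `I_(n.+1.*2) `*` `I_n.+1.
transitivity (\sum_(x \in B) xi (g x).1 (g x).2)%R.
  rewrite -(pair_fsbig _ (fun p k => xi (g (p, k)).1 (g (p, k)).2)); try exact: finite_II.
  by rewrite -fsbig_ord; apply: eq_bigr => p _; rewrite -fsbig_ord.
rewrite -(fsbig_image B g (fun x => xi x.1 x.2)); last by move=> ? ? _ _ /ginj.
apply: fsbig_widen => // -[i j] [_ nB] /=; apply: bx; apply: contra_notT nB => nij.
exists (n + j - i, minn i j)%N; first by split=> /=; lia.
by rewrite /g /=; congr (_, _); lia.
Qed.

(** * Bijection between plane partitions and matrices, size by size *)

Lemma cancel_set_bij T U (A : set T) (B : set U) (f : T -> U) (g : U -> T) :
  (forall x, A x -> B (f x) /\ g (f x) = x) ->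
  (forall y, B y -> A (g y) /\ f (g y) = y) -> set_bij A B f.
Proof.
move=> AB BA; split.
- by move=> x /AB[].
- by move=> x y /set_mem/AB[_ gx] /set_mem/AB[_ gy] fxy; rewrite -gx fxy gy.
- by move=> y /BA[Ag fg]; exists (g y).
Qed.

(** Serves twice: with [hook] the families are the matrices of MacMahon's formula, with [npp_size]
    they are the multiplicities of plane partitions. *)
Definition families (X : choiceType) (v : X -> nat) (n : nat) : set (X -> nat) :=
  [set m | finite_set [set x | m x != 0%N] /\
           (\sum_(x \in [set: X]) (m x * v x)%N)%R = n].

(** Finite support matters: a sum with infinite support is 0 by convention. *)
Lemma leq_fsum (X : choiceType) (F : X -> nat) (r : seq X) :
  finite_set [set x | F x != 0%N] -> uniq r ->
  (\sum_(x <- r) F x <= (\sum_(x \in [set: X]) F x)%R)%N.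
Proof.
move=> finF ur; rewrite (fsbig_supp _ setT) setTI.
have -> : F @^-1` [set~ 0%R] = [set x | F x != 0%N].
  by apply/seteqP; split=> x /eqP.
rewrite fsbig_finite // [leqLHS](bigID (fun x => F x == 0%N)) /=.
rewrite [X in (X + _)%N]big1 ?add0n; last by move=> x /eqP.
rewrite -big_filter; apply: uniq_sub_le_big => //.
- by move=> a b; rewrite leq_addr.
- exact: filter_uniq.
- by move=> x; rewrite mem_filter in_fset_set // inE /= => /andP[].
Qed.

(** A nonzero entry in a row or column of index above [n] forces [n + 1] nonzero entries before it
    in its column or row, hence a size above [n]. *)
Lemma size_boxed n xi : plane_partition xi -> plane_size xi = n -> boxed n xi.
Proof.
move=> [xi1 xi2 fin] sz.
have mono1 i j d : (xi (i + d)%N j <= xi i j)%N.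
  by elim: d => [|d IH]; rewrite ?addn0 // addnS (leq_trans (xi1 _ _)).
have mono2 i j d : (xi i (j + d)%N <= xi i j)%N.
  by elim: d => [|d IH]; rewrite ?addn0 // addnS (leq_trans (xi2 _ _)).
have bound f : injective f ->
    (forall p, (p <= n)%N -> (0 < xi (f p).1 (f p).2)%N) -> False.
  move=> finj fpos.
  have := @leq_fsum _ (fun p => xi p.1 p.2) [seq f p | p <- iota 0 n.+1] fin.
  rewrite map_inj_uniq // iota_uniq => /(_ isT); rewrite -/(plane_size xi) sz.
  rewrite big_map leqNgt => /negP; apply.
  rewrite -[X in (X <= _)%N](size_iota 0) -sum1_size.
  rewrite big_seq [leqRHS]big_seq; apply: leq_sum => p.
  by rewrite mem_iota add0n => /fpos.
move=> i j nij; apply/eqP; rewrite -leqn0 leqNgt; apply/negP => xi0.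
case/orP: nij => [ni|nj].
- apply: (bound (fun p => (p, j))); first by move=> p q [].
  move=> p pn /=; apply: leq_trans xi0 _; have := mono1 p j (i - p)%N.
  by rewrite subnKC //; lia.
- apply: (bound (fun p => (i, p))); first by move=> p q [].
  move=> p pn /=; apply: leq_trans xi0 _; have := mono2 i p (j - p)%N.
  by rewrite subnKC //; lia.
Qed.

Definition plane_partitions_of n : set (nat -> nat -> nat) :=
  [set xi | plane_partition xi /\ plane_size xi = n].

Definition chains_of n : set (seq (nat -> nat)) :=
  [set s | chain zero_part (diag_word n.+1) s /\
           chain_wt n.+1 zero_part (diag_word n.+1) s = n].

Definition matrices_of n : set (seq (seq nat)) :=
  [set nss | matrix_shape n.+1 n.+1 nss /\
             matrix_wt (rev (iota 1 n.+1)) (iota 0 n.+1) nss = n].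

Lemma slices_set_bij n :
  set_bij (plane_partitions_of n) (chains_of n) (slices n).
Proof.
apply: (@cancel_set_bij _ _ _ _ _ (unslice n)).
- move=> xi [pp sz]; have bx := size_boxed pp sz.
  split; last exact: slicesK.
  split; first exact: slicesP.
  by rewrite (chain_wt_diag _ (slicesP pp bx)) psize_slices.
- move=> s [ch wt]; split; last exact: unsliceK.
  split; first exact: unsliceP.
  rewrite -(psize_slices (@unslice_boxed n s)) unsliceK //.
  by rewrite -(chain_wt_diag _ ch).
Qed.

Lemma chain_downs_from_zero bs s : chain zero_part (downs bs) s ->
  s = nseq (size bs) zero_part.
Proof.
elim: bs s => [|b bs IH] [|m s] //= [zm].
have -> : m = zero_part by apply/funext => k; have := zm k; lia.
by move=> /IH ->.
Qed.

Lemma chain_downs_nseq bs : chain zero_part (downs bs) (nseq (size bs) zero_part).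
Proof. by elim: bs => [|b bs IH] //=; split. Qed.

Lemma chain_wt_nseq K bs :
  chain_wt K zero_part (downs bs) (nseq (size bs) zero_part) = 0.
Proof. by elim: bs => //= b bs ->; rewrite subnn muln0. Qed.

(** The down steps left after insertion start at the empty partition and hence stay there, with
    weight 0. So the matrix alone carries the chain and its weight. *)
Lemma insert_rows_set_bij n : set_bij (chains_of n) (matrices_of n)
  (fun s => (insert_rows zero_part n.+1 s).1).
Proof.
have sza : size (rev (iota 1 n.+1)) = n.+1 by rewrite size_rev size_iota.
have szb : size (iota 0 n.+1) = n.+1 by rewrite size_iota.
have szK : (size (iota 0 n.+1) <= n.+1)%N by rewrite szb.
apply: (@cancel_set_bij _ _ _ _ _
   (fun nss => extract_rows zero_part nss (nseq n.+1 zero_part))) => [s [ch wt]|nss [sh wt]].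
  have [] := insert_rowsP szK ch; rewrite sza szb => sh ch2 K1 W1.
  have E := chain_downs_from_zero ch2; rewrite szb in E.
  split; last by rewrite -[RHS]K1 E.
  split=> //; move: W1; rewrite -/(diag_word n.+1) wt E -[in nseq _ _]szb.
  by rewrite chain_wt_nseq addn0.
have ch0 := @chain_downs_nseq (iota 0 n.+1).
have := @extract_rowsP (rev (iota 1 n.+1)) (iota 0 n.+1) zero_part nss.
rewrite sza szb in ch0 * => /(_ _ sh ch0) [ch E].
split; last by rewrite E.
split=> //; have [_ _ _] := insert_rowsP szK ch; rewrite -/(diag_word n.+1) => ->.
by rewrite sza E wt -[in nseq _ _]szb chain_wt_nseq addn0.
Qed.

Definition hook (x : nat * nat) : nat := (x.1 + x.2).+1.

(** Rows are reversed because the up exponents decrease from [n + 1] to 1: row [n - i] has exponent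
    [i + 1], which with the down exponent [j] gives [hook (i, j)]. *)
Definition matrix_fun n (nss : seq (seq nat)) : nat * nat -> nat := fun x =>
  if (x.1 <= n)%N && (x.2 <= n)%N then nth 0 (nth [::] nss (n - x.1)) x.2 else 0.

Lemma matrix_fun_wt n nss :
  (\sum_(x \in [set: nat * nat]) (matrix_fun n nss x * hook x)%N)%R =
  matrix_wt (rev (iota 1 n.+1)) (iota 0 n.+1) nss.
Proof.
rewrite -(@fsbig_widen _ _ _ _ (`I_n.+1 `*` `I_n.+1)) //; last first.
  move=> [i j] [_ nB] /=; rewrite /matrix_fun ifF //=.
  by apply: contra_notF nB => /= /andP[]; rewrite /= !ltnS.
rewrite -(pair_fsbig _ (fun i j => (matrix_fun n nss (i, j) * hook (i, j))%N));
  try exact: finite_II.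
rewrite -fsbig_ord /matrix_wt size_rev size_iota (reindex_inj rev_ord_inj).
apply: eq_bigr => i _; rewrite -fsbig_ord /row_wt size_iota; apply: eq_bigr => j _.
rewrite nth_rev ?size_iota // !nth_iota //; try lia.
rewrite /matrix_fun /hook /= ifT; last by have := ltn_ord i; have := ltn_ord j; lia.
rewrite mulnC; congr (_ * nth _ (nth _ _ _) _)%N; have := ltn_ord i; lia.
Qed.

Lemma families_boxed n A i j : families hook n A -> (n < i)%N || (n < j)%N -> A (i, j) = 0.
Proof.
move=> [fin sz] nij; apply/eqP; apply: contraT => A0.
have := @leq_fsum _ (fun x => A x * hook x)%N [:: (i, j)].
rewrite sz big_seq1 => H; suff : (A (i, j) * hook (i, j) <= n)%N.
  by move: A0; rewrite /hook /=; nia.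
apply: H => //; apply: sub_finite_set fin => x /=.
by rewrite muln_eq0 negb_or => /andP[].
Qed.

Lemma matrix_set_bij n :
  set_bij (matrices_of n) (families hook n) (matrix_fun n).
Proof.
apply: (@cancel_set_bij _ _ _ _ _ (fun A =>
   mkseq (fun i => mkseq (fun j => A ((n - i)%N, j)) n.+1) n.+1)).
  move=> nss [[sz sh] wt]; split.
    split; last by rewrite matrix_fun_wt.
    apply: (@sub_finite_set _ _ (`I_n.+1 `*` `I_n.+1)); last first.
      by apply: finite_setX; exact: finite_II.
    by move=> [i j] /=; rewrite /matrix_fun /=; case: ifP => // /andP[]; rewrite !ltnS.
  apply: (@eq_from_nth _ [::]); rewrite size_mkseq // => i lti.
  have szi : size (nth [::] nss i) = n.+1.
    by apply/eqP/(allP sh); rewrite mem_nth // sz.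
  apply: (@eq_from_nth _ 0); rewrite nth_mkseq // size_mkseq ?szi // => j ltj.
  rewrite nth_mkseq // /matrix_fun /= ifT; last by lia.
  by congr (nth _ (nth _ _ _) _); lia.
move=> A fA.
have E : matrix_fun n (mkseq (fun i => mkseq (fun j => A ((n - i)%N, j)) n.+1) n.+1) = A.
  apply/funext => -[i j]; rewrite /matrix_fun /=; case: ifP => ij; last first.
    by rewrite (families_boxed fA) //; lia.
  by rewrite !nth_mkseq; [congr (A (_, _)); lia | lia | lia].
split=> //; split.
  split; rewrite ?size_mkseq //; apply/allP => _ /mapP[i _ ->].
  by rewrite size_mkseq.
by rewrite -matrix_fun_wt E; case: fA.
Qed.

Lemma plane_partitions_families n : exists f,
  set_bij (plane_partitions_of n) (families hook n) f.
Proof.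
eexists; apply: set_bij_comp (matrix_set_bij n).
apply: set_bij_comp (insert_rows_set_bij n).
exact: slices_set_bij.
Qed.

Local Open Scope ring_scope.

(** * Formal power series *)

Section FpsCoef.
Variable R : comNzRingType.
Implicit Types f g h : {fps R}.

Lemma fpsD f g n : (f + g) n = f n + g n. Proof. by []. Qed.
Lemma fpsB f g n : (f - g) n = f n - g n. Proof. by []. Qed.
Lemma fpsM f g n : (f * g) n = \sum_(i < n.+1) f i * g (n - i)%N.
Proof. by []. Qed.
Lemma fps1 n : (1 : {fps R}) n = (n == 0%N)%:R.
Proof. by rewrite [LHS]/=; case: eqP. Qed.

Lemma fps_sumE I (r : seq I) (P : pred I) (F : I -> {fps R}) n :
  (\sum_(i <- r | P i) F i) n = \sum_(i <- r | P i) F i n.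
Proof.
apply: (big_morph (fun f : {fps R} => f n) (fun f g => fpsD f g n)).
by rewrite [LHS]/= if_same.
Qed.

Lemma fpsC_is_zmod_morphism : zmod_morphism (@fpsC R).
Proof.
by move=> a b; apply/fpsP => n; rewrite fpsB /=; case: eqP => // _; rewrite subr0.
Qed.

Lemma fpsCM_coef a f n : (fpsC a * f) n = a * f n.
Proof.
rewrite fpsM big_ord_recl /= subn0 big1 ?addr0 // => i _.
by rewrite mul0r.
Qed.

Lemma fpsC_is_monoid_morphism : monoid_morphism (@fpsC R).
Proof.
split=> // a b; apply/fpsP => n; rewrite fpsCM_coef /=.
by case: eqP => // _; rewrite mulr0.
Qed.

HB.instance Definition _ :=
  GRing.isZmodMorphism.Build R {fps R} (@fpsC R) fpsC_is_zmod_morphism.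
HB.instance Definition _ :=
  GRing.isMonoidMorphism.Build R {fps R} (@fpsC R) fpsC_is_monoid_morphism.

Lemma fpsXn k n : (fpsX ^+ k : {fps R}) n = (n == k)%:R.
Proof.
elim: k n => [|k IH] n; first by rewrite expr0 fps1.
rewrite exprS fpsM; case: n => [|n].
  by rewrite big_ord_recl big_ord0 /= mul0r addr0.
rewrite big_ord_recl big_ord_recl /= mul0r add0r mul1r subSS subn0 IH eqSS.
by rewrite big1 ?addr0 // => i _; rewrite mul0r.
Qed.

(** Congruence modulo [q^(n+1)], under which infinite sums and products become finite. *)
Definition eq_upto n f g := forall k, (k <= n)%N -> f k = g k.

Lemma eq_upto_refl n f : eq_upto n f f. Proof. by []. Qed.
Lemma eq_upto_sym n f g : eq_upto n f g -> eq_upto n g f.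
Proof. by move=> fg k kn; rewrite fg. Qed.
Lemma eq_upto_trans n f g h : eq_upto n f g -> eq_upto n g h -> eq_upto n f h.
Proof. by move=> fg gh k kn; rewrite fg ?gh. Qed.

Lemma eq_uptoM n f g f' g' : eq_upto n f f' -> eq_upto n g g' ->
  eq_upto n (f * g) (f' * g').
Proof.
move=> ff gg k kn; rewrite !fpsM; apply: eq_bigr => i _.
by rewrite ff ?gg //; have := ltn_ord i; lia.
Qed.

Lemma eq_upto_sum n I (r : seq I) (P : pred I) (F G : I -> {fps R}) :
  (forall i, P i -> eq_upto n (F i) (G i)) ->
  eq_upto n (\sum_(i <- r | P i) F i) (\sum_(i <- r | P i) G i).
Proof.
move=> FG; apply: big_ind2 => // f f' g g' ff gg k kn.
by rewrite !fpsD ff ?gg.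
Qed.

Lemma eq_upto_prod n (I : eqType) (r : seq I) (P : pred I) (F G : I -> {fps R}) :
  (forall i, i \in r -> P i -> eq_upto n (F i) (G i)) ->
  eq_upto n (\prod_(i <- r | P i) F i) (\prod_(i <- r | P i) G i).
Proof.
move=> FG; rewrite big_seq_cond [X in eq_upto _ _ X]big_seq_cond.
apply: big_ind2 => //; first by move=> *; exact: eq_uptoM.
by move=> i /andP[]; exact: FG.
Qed.

Lemma eq_uptoXn n k f g : eq_upto n f g -> eq_upto n (f ^+ k) (g ^+ k).
Proof.
by move=> fg; elim: k => // k IH; rewrite !exprS; apply: eq_uptoM.
Qed.

Lemma coef_expr_lt f k n : f 0%N = 0 -> (n < k)%N -> (f ^+ k) n = 0.
Proof.
move=> f0; elim: k n => // k IH n nk; rewrite exprS fpsM big1 // => -[[|i] ltin] _ /=.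
  by rewrite f0 mul0r.
by rewrite IH ?mulr0 //; lia.
Qed.

Lemma fps_geom (h n : nat) : (0 < h)%N ->
  eq_upto n (\sum_(k < n.+1) fpsX ^+ (h * k)) (1 - fpsX ^+ h : {fps R})^-1.
Proof.
(* The inverse is exhibited: its coefficients are 1 exactly at the multiples of [h]. *)
move=> h0; set g : {fps R} := Fps (fun m => (h %| m)%:R).
have E : (1 - fpsX ^+ h) * g = 1.
  apply/fpsP => m; rewrite mulrBl mul1r fpsB fps1.
  have X : (fpsX ^+ h * g) m = if (h <= m)%N then g (m - h)%N else 0.
    rewrite fpsM; case: leqP => hm; last first.
      rewrite big1 // => i _; rewrite fpsXn; case: eqP => [E|_]; last by rewrite mul0r.
      by have := ltn_ord i; lia.
    have hm' : (h < m.+1)%N by [].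
    rewrite (bigD1 (Ordinal hm')) //= fpsXn eqxx mul1r big1 ?addr0 // => i ih.
    rewrite fpsXn; case: eqP => [E|_]; last by rewrite mul0r.
    by case/eqP: ih; exact: val_inj.
  rewrite X /g /=; case: leqP => hm.
    by rewrite dvdn_subl // subrr; case: (m =P 0%N) => // m0; lia.
  by rewrite subr0; case: m hm {X} => [|m] hm //; rewrite ?dvdn0 // gtnNdvd.
have -> : (1 - fpsX ^+ h : {fps R})^-1 = g by apply: mulr1_eq.
move=> m mn; rewrite fps_sumE /g /=; under eq_bigr do rewrite fpsXn.
case: dvdnP => [[q E']|nd]; last first.
  by rewrite big1 // => i _; case: eqP => // mE; case: nd; exists i; rewrite mulnC.
have qn : (q < n.+1)%N by nia.
rewrite (bigD1 (Ordinal qn)) //= E' mulnC eqxx big1 ?addr0 // => i iq.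
case: eqP => // /eqP; rewrite eqn_pmul2l // => /eqP E2; case/eqP: iq.
exact: val_inj.
Qed.

Lemma eq_upto_invX k n d : (n < k)%N -> eq_upto n ((1 - fpsX ^+ k : {fps R}) ^- d) 1.
Proof.
move=> nk; have k0 : (0 < k)%N by lia.
rewrite -exprVn; apply: (@eq_upto_trans _ _ (1 ^+ d)); last by rewrite expr1n.
apply: eq_uptoXn; apply: (eq_upto_trans (eq_upto_sym (@fps_geom k n k0))).
move=> m mn; rewrite fps_sumE big_ord_recl /= muln0 expr0 big1 ?addr0 // => i _.
by rewrite fpsXn; case: eqP => //; rewrite /bump /= => E; nia.
Qed.

(** Factors of index above [n] are 1 modulo [q^(n+1)], so the partial products stabilize. *)
Lemma macmahon_upto n :
  eq_upto n (macmahon R) (\prod_(1 <= k < n.+1) (1 - fpsX ^+ k) ^- k).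
Proof.
pose u N : {fps R} := \prod_(1 <= k < N) (1 - fpsX ^+ k) ^- k.
have uS N m : (m < N)%N -> u N m = u m.+1 m.
  elim: N => // N IH; rewrite ltnS leq_eqVlt => /orP[/eqP-> //|mN].
  rewrite -IH // /u big_nat_recr /=; last by lia.
  have := eq_uptoM (@eq_upto_refl m (u N)) (eq_upto_invX N mN).
  by rewrite mulr1 => /(_ m (leqnn m)).
have -> : macmahon R = Fps (fun m => u m.+1 m).
  by apply: fps_limP => m; exists m.+1 => N mN; exact: uS.
by move=> k kn; rewrite /= -(uS n.+1).
Qed.

End FpsCoef.

(** * Truncated exponentials *)

Section FpsExp.
(** The morphism [phi] provides inverse factorials in [R], so that rational and polynomial
    coefficients are treated together. *)
Variables (R : comNzRingType) (phi : {rmorphism rat -> R}).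
Implicit Types f g : {fps R}.

Definition exp_upto n f : {fps R} :=
  \sum_(k < n.+1) fpsC (phi (k`!%:R^-1)) * f ^+ k.

Lemma fps_factV k : (k`!%:R : {fps R})^-1 = fpsC (phi (k`!%:R^-1)).
Proof.
apply: mulr1_eq; have -> : (k`!%:R : {fps R}) = fpsC (phi k`!%:R) by rewrite !rmorph_nat.
rewrite -!rmorphM divff ?rmorph1 //.
by rewrite Num.Theory.pnatr_eq0 -lt0n fact_gt0.
Qed.

Lemma fps_exp_coef f n : f 0%N = 0 -> fps_exp f n = exp_upto n f n.
Proof.
move=> f0; have -> : fps_exp f = Fps (fun n => exp_upto n f n) => //.
apply: fps_limP => m; exists m.+1 => N mN /=.
pose H k := fpsC (phi (k`!%:R^-1)) * f ^+ k.
have -> : \sum_(k < N) f ^+ k / k`!%:R = \sum_(0 <= k < N) H k.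
  by rewrite big_mkord; apply: eq_bigr => k _; rewrite fps_factV mulrC.
have -> : exp_upto m f = \sum_(0 <= k < m.+1) H k by rewrite big_mkord.
rewrite (@big_cat_nat _ _ _ m.+1) // fpsD [X in _ + X]fps_sumE [X in _ + X]big_nat
  [X in _ + X]big1 ?addr0 //.
by move=> k /andP[mk _]; rewrite fpsCM_coef coef_expr_lt ?mulr0.
Qed.

Lemma eq_upto_exp n f g : eq_upto n f g -> eq_upto n (exp_upto n f) (exp_upto n g).
Proof.
move=> fg; apply: eq_upto_sum => k _; apply: eq_uptoM; first exact: eq_upto_refl.
exact: eq_uptoXn.
Qed.

Lemma exp_uptoD n f g : f 0%N = 0 -> g 0%N = 0 ->
  eq_upto n (exp_upto n (f + g)) (exp_upto n f * exp_upto n g).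
Proof.
move=> f0 g0; pose F k := fpsC (phi (k`!%:R^-1)) * f ^+ k.
pose G k := fpsC (phi (k`!%:R^-1)) * g ^+ k.
have FG k : fpsC (phi (k`!%:R^-1)) * (f + g) ^+ k = \sum_(i < k.+1) F (k - i)%N * G i.
  rewrite exprDn big_distrr /=; apply: eq_bigr => -[i /= lik] _; rewrite /F /G.
  rewrite mulrACA -!rmorphM mulrnAr -mulrnAl; congr (_ * _).
  rewrite -!rmorphMn; congr (fpsC (phi _)); rewrite -(mulr_natr _ 'C(k, i)).
  have <- : 'C(k, i)%:R * (i`!%:R * (k - i)`!%:R) = k`!%:R :> rat.
    by rewrite -!natrM bin_fact.
  have nz j : (j`!%:R : rat) != 0.
    by rewrite Num.Theory.pnatr_eq0 -lt0n fact_gt0.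
  have bz : ('C(k, i)%:R : rat) != 0.
    by rewrite Num.Theory.pnatr_eq0 -lt0n bin_gt0.
  by rewrite !invfM mulrAC mulVf // mul1r mulrC.
(* [F i * G j] is divisible by [q^(i+j)], so only the triangle [i + j <= n] of the product of the
   two truncations matters; this is what the binomial expansion produces. *)
have FGlt i j m : (m < i + j)%N -> (F i * G j) m = 0.
  move=> mij; rewrite /F /G mulrACA -rmorphM fpsCM_coef fpsM big1 ?mulr0 // => l _.
  case: (ltnP l i) => li; first by rewrite coef_expr_lt ?mul0r.
  by rewrite [X in _ * X]coef_expr_lt ?mulr0 //; have := ltn_ord l; lia.
move=> m mn; rewrite /exp_upto; under eq_bigr do rewrite FG.
rewrite big_distrlr /= !fps_sumE.
transitivity (\sum_(i < n.+1) \sum_(j < n.+1 | (i + j <= n)%N) (F i * G j) m).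
  under eq_bigr do rewrite fps_sumE.
  pose H i j := (F i * G j) m.
  transitivity (\sum_(k < n.+1) \sum_(j < n.+1 | (j <= k)%N) H (k - j)%N j).
    apply: eq_bigr => k _; rewrite (big_ord_widen_cond n.+1 xpredT (fun j => H (k - j)%N j)) //.
  rewrite (exchange_big_dep xpredT) //= [RHS](exchange_big_dep xpredT) //=.
  apply: eq_bigr => j _.
  (* For fixed [j], the substitution of [k + j] for [k] matches the two ranges. *)
  rewrite -(big_mkord (fun k => j <= k)%N (fun k => H (k - j)%N j)).
  rewrite -(big_mkord (fun k => k + j <= n)%N (fun k => H k j)).
  have jn : (j <= n.+1)%N by exact: ltnW.
  rewrite (@big_cat_nat _ _ _ j) //= big_nat_cond big1 ?add0r; last first.
    by move=> i; lia.
  rewrite -{1}[j : nat]add0n big_addn [RHS](@big_cat_nat _ _ _ (n.+1 - j)%N) //=; last by lia.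
  rewrite [X in _ + X]big_nat_cond [X in _ + X]big1 ?addr0; last by move=> i; lia.
  rewrite big_nat_cond [RHS]big_nat_cond; apply: eq_big => i; first by lia.
  by move=> _; rewrite addnK.
apply: eq_bigr => i _; rewrite fps_sumE big_mkcond /=; apply: eq_bigr => j _.
by case: leqP => // nij; apply/esym/FGlt; lia.
Qed.

Lemma exp_upto0 n : exp_upto n 0 = 1.
Proof.
rewrite /exp_upto big_ord_recl big1 ?addr0; last by move=> i _; rewrite expr0n mulr0.
by rewrite expr0 mulr1 fact0 invr1 !rmorph1.
Qed.

Lemma exp_upto_sum n I (r : seq I) (F : I -> {fps R}) :
  (forall i, F i 0%N = 0) ->
  eq_upto n (exp_upto n (\sum_(i <- r) F i)) (\prod_(i <- r) exp_upto n (F i)).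
Proof.
move=> F0; elim: r => [|i r IH]; first by rewrite !big_nil exp_upto0.
rewrite !big_cons; apply: eq_upto_trans (exp_uptoD _ _) _ => //.
  by rewrite fps_sumE big1.
by apply: eq_uptoM.
Qed.

End FpsExp.

(** * Sums over families of multiplicities *)

Section FamiliesSum.
Variables (X : choiceType) (v : X -> nat).
Hypothesis v_gt0 : forall x, (0 < v x)%N.
Hypothesis v_fin : forall n, finite_set [set x | (v x <= n)%N].

Lemma families_le n m x : families v n m -> (m x * v x <= n)%N.
Proof.
move=> [fin sz]; have := @leq_fsum _ (fun x => m x * v x)%N [:: x].
rewrite sz big_seq1; apply=> //; apply: sub_finite_set fin => y /=.
by rewrite muln_eq0 negb_or => /andP[].
Qed.

Let E n := fset_set [set x | (v x <= n)%N].

Let mem_bounded n x : (x \in E n) = (v x <= n)%N.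
Proof. by rewrite in_fset_set //; apply/idP/idP; rewrite inE. Qed.

(** Since [v] is positive, a family of total [n] takes values at most [n] and vanishes where
    [v x > n]. It is thus a finite function on [E n], extended by 0. *)
Let extend n (f : {ffun E n -> 'I_n.+1}) : X -> nat :=
  fun x => if insub x is Some y then val (f y) else 0%N.

Let extend_val n (f : {ffun E n -> 'I_n.+1}) (y : E n) : extend f (val y) = f y.
Proof. by rewrite /extend valK. Qed.

Let extend_out n (f : {ffun E n -> 'I_n.+1}) x : x \notin E n -> extend f x = 0%N.
Proof. by move=> xE; rewrite /extend insubN. Qed.

Let extend_sum n (f : {ffun E n -> 'I_n.+1}) :
  \sum_(x \in [set: X]) (extend f x * v x)%N = (\sum_(y : E n) f y * v (val y))%N.
Proof.
rewrite (fsbigTE (E n)); last by move=> x xE; rewrite extend_out.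
by rewrite big_seq_fsetE /=; apply: eq_bigr => y _; rewrite extend_val.
Qed.

Let extend_bij n :
  set_bij [set f : {ffun E n -> 'I_n.+1} | (\sum_(y : E n) f y * v (val y))%N == n]
    (families v n) (@extend n).
Proof.
apply: (@cancel_set_bij _ _ _ _ _
    (fun m => [ffun y : E n => inord (m (val y))] : {ffun E n -> 'I_n.+1})).
  move=> f /= /eqP sf; split.
    split; last by rewrite extend_sum.
    apply: (@sub_finite_set _ _ [set` E n]) => //= x /=.
    by apply: contra_neqT => /extend_out ->.
  by apply/ffunP => y; rewrite ffunE extend_val inord_val.
move=> m fm.
have mn x : (m x <= n)%N by have := families_le x fm; have := v_gt0 x; nia.
have H : extend [ffun y : E n => inord (m (val y))] = m.
  apply/funext => x; case: (boolP (x \in E n)) => [xE|xE].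
    by rewrite -[x]/(val [` xE]%fset) extend_val ffunE inordK // ltnS.
  rewrite extend_out //; move: xE; rewrite mem_bounded.
  by have := families_le x fm; case: (m x) => // k; nia.
by split=> //=; rewrite -extend_sum H; case: fm => _ ->.
Qed.

Lemma families_finite n : finite_set (families v n).
Proof.
have [_ _ surj] := extend_bij n; apply: (sub_finite_set surj).
exact/finite_image/finite_finset.
Qed.

(** Expanding the product chooses a multiplicity for each [x], and the coefficient of [q^n] keeps
    the choices of total [n]. Elements outside the product have multiplicity 0 and contribute
    [c 0 = 1]. *)
Lemma families_sum (R : comNzRingType) (c : nat -> R) n : c 0%N = 1 ->
  \sum_(m \in families v n) \big[*%R/1]_(x \in [set: X]) c (m x) =
  (\prod_(x <- fset_set [set x | (v x <= n)%N])
     \sum_(k < n.+1) fpsC (c k) * fpsX ^+ (v x * k)) n.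
Proof.
move=> c0; rewrite (reindex_fsbig (@extend n) _ _ _ (extend_bij n)) -/(E n).
rewrite [in RHS]big_seq_fsetE /= bigA_distr_bigA /= fps_sumE.
rewrite -(@bigfs _ _ _ _ (index_enum _)
  (fun f : {ffun E n -> 'I_n.+1} => (\sum_(y : E n) f y * v (val y))%N == n)
  (fun f => \big[*%R/1]_(x \in [set: X]) c (extend f x))).
- rewrite big_mkcond; apply: eq_bigr => f _.
  rewrite big_split -(rmorph_prod (@fpsC R)) -expr_sum fpsCM_coef fpsXn.
  have -> : \big[*%R/1]_(x \in [set: X]) c (extend f x) = \prod_(y : E n) c (f y).
    rewrite (fsbigTE (E n)); last by move=> x xE; rewrite extend_out.
    by rewrite big_seq_fsetE /=; apply: eq_bigr => y _; rewrite extend_val.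
  rewrite eq_sym; have -> : (\sum_y v (val y) * f y = \sum_y f y * v (val y))%N.
    by apply: eq_bigr => y _; rewrite mulnC.
  by case: eqP; rewrite ?mulr1 ?mulr0.
- exact: index_enum_uniq.
- by move=> f _; rewrite mem_index_enum.
Qed.

End FamiliesSum.

(** * MacMahon's formula *)

Lemma hook_gt0 x : (0 < hook x)%N. Proof. by []. Qed.

Lemma hook_fin n : finite_set [set x | (hook x <= n)%N].
Proof.
apply: (@sub_finite_set _ _ (`I_n.+1 `*` `I_n.+1)); last first.
  by apply: finite_setX; exact: finite_II.
by move=> [i j]; rewrite /hook /=; lia.
Qed.

Lemma plane_partitions_finite n : finite_set (plane_partitions_of n).
Proof.
have [f [fA finj _]] := plane_partitions_families n.
rewrite -(eq_finite_set (inj_card_eq finj)).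
by apply: sub_finite_set (families_finite hook_gt0 hook_fin n) => _ [x /fA fx <-].
Qed.

(** Exactly [k] pairs satisfy [i + j + 1 = k]. From [n] to [n + 1], each of the [n] old rows gains a
    factor [g (n + 1)], and one row with that single factor appears. *)
Lemma prod_triangle (R : comNzRingType) (g : nat -> R) n :
  \prod_(i < n) \prod_(j < n - i) g (i + j).+1 = \prod_(1 <= k < n.+1) g k ^+ k.
Proof.
elim: n => [|n IH]; first by rewrite big_ord0 big_geq.
rewrite big_nat_recr //= -IH big_ord_recr /= subSnn big_ord1 addn0.
rewrite exprSr mulrA; congr (_ * _).
transitivity (\prod_(i < n) ((\prod_(j < n - i) g (i + j).+1) * g n.+1)).
  apply: eq_bigr => i _; rewrite subSn ?(ltnW (ltn_ord i)) // big_ord_recr /=.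
  by rewrite subnKC // ltnW.
by rewrite big_split /= prodr_const card_ord.
Qed.

Lemma prod_hook (R : comNzRingType) (g : nat -> R) n :
  \prod_(x <- fset_set [set x | (hook x <= n)%N]) g (hook x) =
  \prod_(1 <= k < n.+1) g k ^+ k.
Proof.
rewrite -prod_triangle.
rewrite (perm_big [seq (i, j) | i <- iota 0 n, j <- iota 0 (n - i)]) /=.
  rewrite big_allpairs_dep /= -[X in iota 0 X]subn0 -/(index_iota 0 n) big_mkord.
  apply: eq_bigr => i _.
  by rewrite -[X in iota 0 X]subn0 -/(index_iota 0 (n - i)) big_mkord.
apply: uniq_perm; first exact: fset_uniq.
  apply: allpairs_uniq_dep; rewrite ?iota_uniq //; first by move=> *; exact: iota_uniq.
  by move=> [a b] [c d] _ _ /= [-> ->].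
move=> [i j]; rewrite in_fset_set; last exact: hook_fin.
apply/idP/allpairsPdep; rewrite inE /=; [move=> H | move=> [a [b [+ + [-> ->]]]]].
  by exists i, j; rewrite !mem_iota; move: H; rewrite /hook /=; split=> //; lia.
by rewrite !mem_iota /hook /=; lia.
Qed.

(** With all [c k = 1], the factors of [families_sum] are truncated geometric series. *)
Lemma macmahon_coef (R : comNzRingType) n :
  macmahon R n = \sum_(m \in families hook n) (1 : R).
Proof.
have := @families_sum _ hook hook_gt0 hook_fin R (fun=> 1) n erefl.
under eq_fsbigr do rewrite fsbig1 //; move=> ->.
rewrite (macmahon_upto _ (leqnn n)).
under [in RHS]eq_bigr do under eq_bigr do rewrite rmorph1 mul1r.
transitivity ((\prod_(x <- fset_set [set x | (hook x <= n)%N])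
   (1 - fpsX ^+ hook x : {fps R})^-1) n).
  rewrite (prod_hook (fun k => (1 - fpsX ^+ k : {fps R})^-1)).
  by congr (_ _ n); apply: eq_bigr => k _; rewrite exprVn.
apply: (@eq_upto_prod _ n); last exact: leqnn.
by move=> x _ _; apply/eq_upto_sym/fps_geom.
Qed.

Lemma macmahon_plane_partitions (R : comNzRingType) n :
  macmahon R n = \sum_(xi \in plane_partitions_of n) (1 : R).
Proof.
have [f /(reindex_fsbig _ _ _ (fun=> 1 : R)) H] := plane_partitions_families n.
by rewrite macmahon_coef H.
Qed.

(** * Superpositions of plane partitions *)

Definition npp_size (x : npp) : nat := plane_size (val x).

Lemma nppP (x : npp) : nonempty_plane_partition (val x).
Proof. exact: set_valP. Qed.

Lemma plane_size_ge xi i j : plane_partition xi -> (xi i j <= plane_size xi)%N.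
Proof.
move=> [_ _ fin].
by have := @leq_fsum _ (fun p => xi p.1 p.2) [:: (i, j)] fin isT; rewrite big_seq1.
Qed.

Lemma npp_size_gt0 x : (0 < npp_size x)%N.
Proof.
have [pp [i [j xij]]] := nppP x.
by have := plane_size_ge i j pp; rewrite /npp_size; lia.
Qed.

Lemma npp_fin n : finite_set [set x | (npp_size x <= n)%N].
Proof.
have vinj : {in [set x | (npp_size x <= n)%N] &, injective (val : npp -> _)}.
  by move=> x y _ _; exact: val_inj.
rewrite -(eq_finite_set (inj_card_eq vinj)).
apply: (@sub_finite_set _ _ (\bigcup_(k in `I_n.+1) plane_partitions_of k)).
  move=> _ [x /= xn <-]; exists (npp_size x) => //.
  by split=> //; case: (nppP x).
apply: bigcup_finite; first exact: finite_II.
by move=> k _; exact: plane_partitions_finite.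
Qed.

Lemma plane_size_gt0 xi : plane_partition xi -> (0 < plane_size xi)%N ->
  nonempty_plane_partition xi.
Proof.
move=> pp; rewrite lt0n => s0; split=> //; apply: contrapT => H; case/eqP: s0.
apply: fsbig1 => -[i j] _ /=; apply/eqP; apply: contrapT => xij.
by case: H; exists i, j; apply/negP.
Qed.

Lemma npp_set_bij m : (0 < m)%N ->
  set_bij [set x | npp_size x = m] (plane_partitions_of m) (val : npp -> _).
Proof.
move=> m0; split.
- by move=> x /= <-; split=> //; case: (nppP x).
- by move=> x y _ _; exact: val_inj.
- move=> xi [pp sz]; have ne : nonempty_plane_partition xi.
    by apply: plane_size_gt0; rewrite ?sz.
  by exists (SigSub (mem_set ne)).
Qed.

(** Subtracting 1 removes the empty plane partition, the only one of size 0. *)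
Lemma sum_npp_upto (R : comNzRingType) n :
  eq_upto n (\sum_(x <- fset_set [set x | (npp_size x <= n)%N]) fpsX ^+ npp_size x)
    (macmahon R - 1).
Proof.
move=> m mn; rewrite fps_sumE fpsB fps1.
under eq_bigr do rewrite fpsXn.
case: m mn => [|m] mn.
  rewrite (macmahon_upto _ (leqnn 0)) big_geq // fps1 subrr big1 // => x _.
  by have := npp_size_gt0 x; case: npp_size.
rewrite subr0 macmahon_plane_partitions.
rewrite (reindex_fsbig _ _ _ _ (@npp_set_bij m.+1 isT)).
rewrite -fsbig_finite; last exact: npp_fin.
have <- : [set x | (npp_size x <= n)%N] `&` [set x | npp_size x = m.+1] =
          [set x | npp_size x = m.+1].
  by apply/seteqP; split=> x /=; [case | move=> ->].
rewrite fsbig_mkcondr; apply: eq_fsbigr => x _.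
have [xm|xm] := pselect (npp_size x = m.+1).
  by rewrite xm eqxx ifT // inE.
by rewrite ifN ?notin_setE //; case: eqP => // /esym.
Qed.

Definition superpose (m : npp -> nat) (i j k : nat) : nat :=
  \sum_(x \in [set: npp]) (m x * binary_repr (val x) i j k)%N.

Lemma decompositionsE pi : decompositions pi =
  [set m | finite_set [set x | m x != 0%N] /\ superpose m = pi].
Proof.
apply/seteqP; split=> m [fin H]; split=> //.
  by apply/funext => i; apply/funext => j; apply/funext => k; rewrite H.
by move=> i j k; rewrite -H.
Qed.

Lemma sum_ltn K a : (\sum_(k < K) (k < a))%N = minn K a.
Proof.
elim: K => [|K IH]; first by rewrite big_ord0 min0n.
by rewrite big_ord_recr /= {}IH /minn; case: (ltnP K a); case: (ltnP K.+1 a) => /=; lia.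
Qed.

Section Superpose.
Variable m : npp -> nat.
Hypothesis m_fin : finite_set [set x | m x != 0%N].

Let S := fset_set [set x | m x != 0%N].

Let sum_supp (F : npp -> nat) : (\sum_(x \in [set: npp]) (m x * F x)%N = \sum_(x <- S) m x * F x)%N.
Proof.
apply: fsbigTE => x; rewrite in_fset_set // => /negP H.
suff -> : m x = 0%N by rewrite mul0n.
by apply/eqP; apply: contraT => mx; case: H; rewrite inE.
Qed.

(** Exceeds the size of every plane partition in the support, so all their binary representations
    vanish outside the cube of side [N]. *)
Let N := (\sum_(x <- S) npp_size x).+1.

Let size_lt x : x \in S -> (npp_size x < N)%N.
Proof.
by move=> xS; rewrite ltnS (big_rem x) //= leq_addr.
Qed.

Let out_box x i j k : x \in S -> (N <= i)%N || (N <= j)%N || (N <= k)%N ->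
  binary_repr (val x) i j k = 0%N.
Proof.
move=> /size_lt xN out; have [pp _] := nppP x; rewrite /binary_repr.
have [iN|iN] := boolP ((N <= i)%N || (N <= j)%N).
  rewrite (size_boxed pp erefl) //.
  by case/orP: iN => iN; rewrite (leq_trans xN iN) ?orbT.
move: out; rewrite (negbTE iN) /= => kN.
by rewrite ltnNge (leq_trans (plane_size_ge i j pp)) // (leq_trans (ltnW xN)).
Qed.

Let superposeE i j k : superpose m i j k = (\sum_(x <- S) m x * binary_repr (val x) i j k)%N.
Proof. exact: sum_supp. Qed.

Let superpose_out i j k : (N <= i)%N || (N <= j)%N || (N <= k)%N ->
  superpose m i j k = 0%N.
Proof.
move=> out; rewrite superposeE big_seq big1 // => x xS.
by rewrite out_box ?muln0.
Qed.

Lemma superpose_solid : solid_partition (superpose m).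
Proof.
have mono i j k i' j' k' :
    (forall x : npp, (binary_repr (val x) i' j' k' <= binary_repr (val x) i j k)%N) ->
    (superpose m i' j' k' <= superpose m i j k)%N.
  by move=> H; rewrite !superposeE; apply: leq_sum => x _; rewrite leq_mul2l H orbT.
split.
- move=> i j k; apply: mono => x; have [[H _ _] _] := nppP x.
  by rewrite /binary_repr; have := H i j; lia.
- move=> i j k; apply: mono => x; have [[_ H _] _] := nppP x.
  by rewrite /binary_repr; have := H i j; lia.
- by move=> i j k; apply: mono => x; rewrite /binary_repr; lia.
- apply: (@sub_finite_set _ _ (`I_N `*` `I_N `*` `I_N)); last first.
    by apply: finite_setX; [apply: finite_setX|]; exact: finite_II.
  move=> [[i j] k] /= p0; suff : [&& i < N, j < N & k < N]%N by case/and3P.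
  by apply: contra_neqT p0 => out; apply: superpose_out; lia.
Qed.

(** The corner entry of a plane partition is its largest, so it is positive when the partition is
    nonempty. *)
Lemma superpose_corner : superpose m 0 0 0 = (\sum_(x \in [set: npp]) m x)%R.
Proof.
rewrite /superpose; apply: eq_fsbigr => x _.
have [[H1 H2 _] [i [j xij]]] := nppP x; rewrite /binary_repr.
suff -> : (0 < val x 0%N 0%N)%N by rewrite muln1.
have A i' j' : (val x i' j' <= val x 0%N j')%N.
  by elim: i' => // i'; apply: leq_trans.
have B j' : (val x 0%N j' <= val x 0%N 0%N)%N.
  by elim: j' => // j'; apply: leq_trans.
by rewrite (leq_trans _ (B j)) // (leq_trans _ (A i j)) // lt0n.
Qed.

(** Summing over [k] first turns the binary representation back into the entry [xi i j]; the rest is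
    exchange of finite sums over the cube. *)
Lemma superpose_size : solid_size (superpose m) =
  (\sum_(x \in [set: npp]) (m x * npp_size x)%N)%R.
Proof.
rewrite sum_supp /solid_size.
rewrite -(@fsbig_widen _ _ _ _ (`I_N `*` `I_N `*` `I_N)) //; last first.
  move=> [[i j] k] [_ nB] /=; apply: superpose_out; apply: contra_notT nB => /=; lia.
rewrite -(pair_fsbig _ (fun p k => superpose m p.1 p.2 k)) /=;
  [|by apply: finite_setX; exact: finite_II|exact: finite_II].
rewrite -(pair_fsbig _ (fun i j => \sum_(k \in `I_N) superpose m i j k)) /=; try exact: finite_II.
transitivity (\sum_(i < N) \sum_(j < N) \sum_(k < N)
    \sum_(x <- S) m x * binary_repr (val x) i j k)%N.
  rewrite -fsbig_ord; apply: eq_bigr => i _; rewrite -fsbig_ord.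
  apply: eq_bigr => j _; rewrite -fsbig_ord; apply: eq_bigr => k _.
  exact: superposeE.
transitivity (\sum_(i < N) \sum_(j < N) \sum_(x <- S)
    m x * \sum_(k < N) binary_repr (val x) i j k)%N.
  apply: eq_bigr => i _; apply: eq_bigr => j _; rewrite exchange_big.
  by apply: eq_bigr => x _; rewrite big_distrr.
transitivity (\sum_(i < N) \sum_(x <- S)
    m x * \sum_(j < N) \sum_(k < N) binary_repr (val x) i j k)%N.
  apply: eq_bigr => i _; rewrite exchange_big.
  by apply: eq_bigr => x _; rewrite big_distrr.
rewrite exchange_big /= big_seq [RHS]big_seq; apply: eq_bigr => x xS.
have [pp _] := nppP x.
rewrite -big_distrr /=; congr (_ * _)%N.
rewrite /npp_size /plane_size.
rewrite -(@fsbig_widen _ _ _ _ (`I_N `*` `I_N)) //; last first.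
  move=> [i j] [_ nB] /=; apply: (size_boxed pp erefl).
  have := size_lt xS; rewrite /npp_size => xN.
  apply: contra_notT nB; rewrite negb_or -!leqNgt => /andP[ix jx].
  by split; exact: leq_ltn_trans xN.
rewrite -(pair_fsbig _ (fun i j => val x i j)) /=; try exact: finite_II.
rewrite -fsbig_ord; apply: eq_bigr => i _; rewrite -fsbig_ord; apply: eq_bigr => j _.
rewrite /binary_repr sum_ltn; apply/minn_idPr.
exact: leq_trans (plane_size_ge i j pp) (ltnW (size_lt xS)).
Qed.

End Superpose.

Definition family_weight (m : npp -> nat) : rat :=
  \big[*%R/1]_(x \in [set: npp]) ((m x)`!%:R^-1 : rat).

Lemma decompositions_families pi :
  decompositions pi `<=` families npp_size (solid_size pi).
Proof.
by rewrite decompositionsE => m [fin <-]; split=> //; rewrite superpose_size.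
Qed.

Lemma families_superpose n m : families npp_size n m ->
  [/\ solid_partition (superpose m), solid_size (superpose m) = n &
      decompositions (superpose m) m].
Proof.
move=> [fin sz]; split; first exact: superpose_solid.
- by rewrite superpose_size.
- by rewrite decompositionsE.
Qed.

(** The separate convention for the empty solid partition agrees with the general formula: its only
    decomposition is the zero family, of weight 1. *)
Lemma omega_cE pi : omega_c pi = \sum_(m \in decompositions pi) family_weight m.
Proof.
rewrite /omega_c; case: asboolP => // pi0.
have -> : decompositions pi = [set fun=> 0%N].
  apply/seteqP; split=> [m dm|_ ->].
    have s0 : solid_size pi = 0%N by apply: fsbig1 => p _; rewrite pi0.
    have := decompositions_families dm; rewrite s0 => fm.
    apply/funext => x; have := families_le x fm.
    by have := npp_size_gt0 x; case: (m x) => // k; nia.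
  split; first by apply: (@sub_finite_set _ _ set0) => // x /=; rewrite eqxx.
  by move=> i j k; rewrite pi0 fsbig1.
by rewrite fsbig_set1 /family_weight fsbig1 // fact0 invr1.
Qed.

(** * The generating function of solid partitions *)

Section WeightedSum.
Variables (R : comNzRingType) (phi : {rmorphism rat -> R}) (t : R).

Lemma family_coef n m : families npp_size n m ->
  \big[*%R/1]_(x \in [set: npp]) (phi ((m x)`!%:R^-1) * t ^+ m x) =
  phi (family_weight m) * t ^+ superpose m 0%N 0%N 0%N.
Proof.
move=> [fin _]; rewrite superpose_corner /family_weight.
pose S := fset_set [set x | m x != 0%N].
have out x : x \notin S -> m x = 0%N.
  rewrite in_fset_set // => /negP H; apply/eqP; apply: contraT => mx.
  by case: H; rewrite inE.
rewrite !(fsbigTE S); try by move=> x /out ->; rewrite ?fact0 ?invr1 ?rmorph1 ?mulr1.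
by rewrite rmorph_prod big_split expr_sum.
Qed.

(** Each family of total size [n] decomposes exactly one solid partition, its superposition, which
    has size [n]. The families are grouped accordingly. *)
Lemma solid_sum_coef n :
  fps_sum solid_partition (fun pi =>
    fpsC (phi (omega_c pi) * t ^+ pi 0%N 0%N 0%N) * fpsX ^+ solid_size pi) n =
  \sum_(m \in families npp_size n)
    \big[*%R/1]_(x \in [set: npp]) (phi ((m x)`!%:R^-1) * t ^+ m x).
Proof.
have finF := families_finite npp_size_gt0 npp_fin n.
pose D := superpose @` families npp_size n.
have finD : finite_set D by exact: finite_image.
pose G m := phi (family_weight m) * t ^+ superpose m 0%N 0%N 0%N.
pose T pi : {fps R} :=
  fpsC (phi (omega_c pi) * t ^+ pi 0%N 0%N 0%N) * fpsX ^+ solid_size pi.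
rewrite -[LHS]/(\sum_(pi \in solid_partition) T pi n).
transitivity (\sum_(pi \in D) \sum_(m \in families npp_size n)
    if superpose m == pi then G m else 0).
  rewrite -(@fsbig_widen _ _ _ _ D) //; first last.
  (* Outside [D], either the size is not [n] or there is no decomposition and [omega_c] is an empty
     sum. *)
  - move=> pi [spi nD]; rewrite -[_ pi]/(T pi n = 0) fpsCM_coef fpsXn.
    case: eqP => [sz|]; last by rewrite mulr0.
    rewrite omega_cE fsbig1 ?rmorph0 ?mul0r // => m dm; case: nD; exists m.
      by rewrite sz; exact: decompositions_families.
    by move: dm; rewrite decompositionsE => -[].
  - by move=> _ [m fm <-]; case: (families_superpose fm).
  apply: eq_fsbigr => pi /set_mem [m0 fm0 m0pi].
  have [_ sz _] := families_superpose fm0; rewrite m0pi in sz.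
  rewrite /T fpsCM_coef fpsXn sz eqxx mulr1 omega_cE.
  have dE : decompositions pi = families npp_size n `&` [set m | superpose m = pi].
    apply/seteqP; split=> [m dm|m [fm <-]]; last by case: (families_superpose fm).
    split; first by rewrite -sz; exact: decompositions_families.
    by move: dm; rewrite decompositionsE => -[].
  have finD' : finite_set (decompositions pi) by rewrite dE; exact: finite_setIl.
  transitivity (\sum_(m \in decompositions pi) G m).
    rewrite !fsbig_finite // rmorph_sum big_distrl /= big_seq [RHS]big_seq.
    apply: eq_bigr => m; rewrite in_fset_set // inE decompositionsE /G.
    by move=> [_ ->].
  rewrite dE fsbig_mkcondr; apply: eq_fsbigr => m _.
  case: eqP => [mpi|mpi]; first by rewrite ifT // inE.
  by rewrite ifN // notin_setE.
rewrite exchange_fsbig //; apply: eq_fsbigr => m /set_mem fm.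
rewrite (family_coef fm) -/(G m) (fsbigD1 (superpose m)) //; last by exists m.
rewrite eqxx fsbig1 /= ?addr0 // => pi [_ /eqP npi].
by rewrite eq_sym (negbTE npi).
Qed.

Lemma solid_sum_exp :
  fps_sum solid_partition (fun pi =>
    fpsC (phi (omega_c pi) * t ^+ pi 0%N 0%N 0%N) * fpsX ^+ solid_size pi) =
  fps_exp (fpsC t * (macmahon R - 1)).
Proof.
apply/fpsP => n; rewrite solid_sum_coef.
(* With this [c], the factor at [x] is the truncated exponential of [t q^|x|]. *)
rewrite (families_sum npp_size_gt0 npp_fin (c := fun k => phi (k`!%:R^-1) * t ^+ k));
  last by rewrite fact0 invr1 rmorph1 mulr1.
have X0 x : (fpsC t * fpsX ^+ npp_size x : {fps R}) 0%N = 0.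
  rewrite fpsCM_coef fpsXn; have := npp_size_gt0 x.
  by case: npp_size => // k _; rewrite mulr0.
have E : eq_upto n (fpsC t * (macmahon R - 1))
    (\sum_(x <- fset_set [set x | (npp_size x <= n)%N]) fpsC t * fpsX ^+ npp_size x).
  rewrite -big_distrr; apply: eq_uptoM; first exact: eq_upto_refl.
  exact/eq_upto_sym/sum_npp_upto.
rewrite (fps_exp_coef phi); last by rewrite E // fps_sumE big1.
rewrite (eq_upto_exp phi E (leqnn n)) (exp_upto_sum phi _ X0 (leqnn n)).
congr (_ _ n); apply: eq_bigr => x _; apply: eq_bigr => k _.
by rewrite exprMn -rmorphXn mulrA -rmorphM exprM.
Qed.

End WeightedSum.

(* The formal variable t is the indeterminate of {poly rat}. *)
Theorem proposition4p11 :
  fps_sum solid_partition (fun pi =>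
      fpsC (omega_c pi *: 'X^(pi 0 0 0)%N) * fpsX ^+ solid_size pi)
    = fps_exp (fpsC 'X * (macmahon {poly rat} - 1))
  /\
  fps_sum solid_partition (fun pi => fpsC (omega_c pi) * fpsX ^+ solid_size pi)
    = fps_exp (macmahon rat - 1).
Proof.
split.
(* Both identities are instances of [solid_sum_exp]: here [t] is ['X] with scalars embedded by
   [polyC], below [t] is 1 over [rat] itself. *)
- rewrite -(solid_sum_exp polyC); congr fps_sum; apply/funext => pi.
  by rewrite mul_polyC.
- rewrite -[macmahon rat - 1]mul1r -(rmorph1 (@fpsC rat)) -(solid_sum_exp idfun).
  by congr fps_sum; apply/funext => pi; rewrite expr1n mulr1.
Qed.
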